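(* Let $q\in(0,1)$, let $\alpha$ be a real number and let $\beta\ge 0$. If $2\alpha\le 1\le\beta$, then the function $x\mapsto f_{\alpha,\beta}(x;q)$ is logarithmically completely monotonic on $(0,\infty)$.
   Context: For $0<q<1$ and $x>0$, the $q$-gamma function is $\Gamma_q(x)=(1-q)^{1-x}\prod_{j=0}^{\infty}\frac{1-q^{j+1}}{1-q^{j+x}}$. The dilogarithm is $\mathrm{Li}_2(z)=-\int_0^z\frac{\log(1-t)}{t}\,dt$ for $0<z<1$. For $q\in(0,1)$, real $\alpha$, and $\beta\ge 0$, define $$f_{\alpha,\beta}(x;q)=\frac{\Gamma_q(x+\beta)\exp\left(-\frac{\mathrm{Li}_2(1-q^x)}{\log q}\right)}{\left(\frac{1-q^x}{1-q}\right)^{x+\beta-\alpha}},\qquad x>0.$$ A positive function $f$ on an interval $I$ is logarithmically completely monotonic on $I$ if it has derivatives of all orders and $(-1)^n(\log f)^{(n)}(x)\ge 0$ for all $x\in I$ and all integers $n\ge 1$. *)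

(* Defs.v *)
(* Stdlib reals with Coquelicot. *)
From Stdlib Require Import Reals.
From Coquelicot Require Import Coquelicot.
Open Scope R_scope.

(* The infinite product is the limit of its partial products; for 0 < q < 1
   and 0 < x it converges, so the projection [real] loses nothing there. *)
Definition qgamma (q x : R) : R :=
  Rpower (1 - q) (1 - x) *
  real (Lim_seq (fun n : nat =>
    prod_f_R0
      (fun j : nat => (1 - q ^ (j + 1)) / (1 - Rpower q (INR j + x))) n)).

(* The singularity of the integrand at 0 is removable, so for 0 < z < 1 this is
   a proper Riemann integral, whatever value the integrand takes at 0. *)
Definition dilog (z : R) : R := - RInt (fun t => ln (1 - t) / t) 0 z.

Definition f_ab (alpha beta q x : R) : R :=
  qgamma q (x + beta) * exp (- (dilog (1 - Rpower q x) / ln q)) /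
  Rpower ((1 - Rpower q x) / (1 - q)) (x + beta - alpha).

(* The interval is the open one with extended-real endpoints a and b, so that
   the two-sided derivatives of Coquelicot are the intended ones.
   [ex_derive_n f n] only asserts differentiability of the (n-1)-th derivative,
   hence the quantification over all n. *)
Definition log_completely_monotonic (f : R -> R) (a b : Rbar) : Prop :=
  (forall x : R, Rbar_lt a x -> Rbar_lt x b -> 0 < f x) /\
  (forall (n : nat) (x : R), Rbar_lt a x -> Rbar_lt x b -> ex_derive_n f n x) /\
  (forall (n : nat) (x : R), (1 <= n)%nat -> Rbar_lt a x -> Rbar_lt x b ->
     0 <= (-1) ^ n * Derive_n (fun t => ln (f t)) n x).

(* Main.v *)
Require Import Defs.
From Stdlib Require Import Reals Lra Lia.
From Coquelicot Require Import Coquelicot.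
Open Scope R_scope.

(** Put u = q^x, which decreases from 1 to 0 as x runs through (0, oo). The
    logarithmic derivative of f is a power series in u,

      (log f)'(x) = sum_k c_k u^k,

    and d/dx multiplies the k-th coefficient of such a series by k log q < 0.
    If every c_k is <= 0, the signs of (log f)', (log f)'', ... therefore
    alternate, starting with a negative one. Computing the c_k and bounding them
    is the whole proof.

    - Gamma_q. The series P(u) = sum_{k>=1} u^k / (k (1 - q^k)) satisfies
      P(u) - P(q u) = - log (1 - u) coefficient by coefficient. The logarithm of
      a partial product of Gamma_q hence telescopes, and since P(q^n u) tends to
      P(0) = 0, Gamma_q(y) = (1-q)^(1-y) exp (P(q^y) - P(q))
      ([qgamma_eq_exp]); no double series has to be rearranged.
    - Dilogarithm. d/dx Li_2(1 - q^x) = x (log q)^2 u / (1-u). After division by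
      - log q this cancels the term in x that comes from differentiating
      - (x + beta - alpha) log (1 - u), so that the derivative depends on x
      through u only ([is_derive_log_f]).
    - Coefficients. With t = - k log q > 0,

        c_k = - log q (1/t - (beta - alpha) - e^(-beta t) / (1 - e^(-t))),

      and the bracket is <= 0 when 2 alpha <= 1 <= beta
      ([laplace_kernel_le]); for alpha = 1/2, beta = 1 this is the inequality
      tanh (t/2) <= t/2.

    Smoothness of f = exp (log f) does not need higher chain or product
    formulas: f solves f' = f * (log f)', so the differentiability of f gains
    one order at a time ([differentiable_upto_ode]). *)

(** * Functions differentiable finitely many times on an open set *)

(** Carrying a derivative valid on all of [D], instead of iterating the total
    operator [Derive], makes closure under products an induction on [n] without
    the Leibniz formula. *)
Fixpoint differentiable_upto (D : R -> Prop) (n : nat) (f : R -> R) : Prop :=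
  match n with
  | O => True
  | S m => exists g, (forall x, D x -> is_derive f x (g x)) /\
                     differentiable_upto D m g
  end.

Lemma differentiable_upto_pred D n f :
  differentiable_upto D (S n) f -> differentiable_upto D n f.
Proof.
  revert f; induction n as [|n IH]; intros f [g [Hg Hn]]; [exact I|].
  exists g; split; [exact Hg | exact (IH g Hn)].
Qed.

Lemma differentiable_upto_plus D n f g :
  differentiable_upto D n f -> differentiable_upto D n g ->
  differentiable_upto D n (fun x => f x + g x).
Proof.
  revert f g; induction n as [|n IH]; intros f g; [easy|].
  intros [f' [Hf Hf']] [g' [Hg Hg']].
  exists (fun x => f' x + g' x); split; [|exact (IH _ _ Hf' Hg')].
  intros x Hx; exact (is_derive_plus f g x _ _ (Hf x Hx) (Hg x Hx)).
Qed.

Lemma differentiable_upto_mult D n f g :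
  differentiable_upto D n f -> differentiable_upto D n g ->
  differentiable_upto D n (fun x => f x * g x).
Proof.
  revert f g; induction n as [|n IH]; intros f g Hf Hg; [easy|].
  pose proof (differentiable_upto_pred _ _ _ Hf) as Hf0.
  pose proof (differentiable_upto_pred _ _ _ Hg) as Hg0.
  destruct Hf as [f' [Hf Hf']], Hg as [g' [Hg Hg']].
  exists (fun x => f' x * g x + f x * g' x); split.
  - intros x Hx.
    exact (is_derive_mult f g x _ _ (Hf x Hx) (Hg x Hx) Rmult_comm).
  - apply differentiable_upto_plus; apply IH; assumption.
Qed.

(** Bootstrapping: if [f] has [n] derivatives then so does [f * G], which is the
    derivative of [f]. *)
Lemma differentiable_upto_ode D f G :
  (forall x, D x -> is_derive f x (f x * G x)) ->
  (forall n, differentiable_upto D n G) ->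
  forall n, differentiable_upto D n f.
Proof.
  intros Hf HG; induction n as [|n IH]; [exact I|].
  exists (fun x => f x * G x); split; [exact Hf|].
  apply differentiable_upto_mult; [exact IH | apply HG].
Qed.

Lemma Derive_n_S_of_is_derive (D : R -> Prop) f g n x :
  open D -> (forall t, D t -> is_derive f t (g t)) -> D x ->
  Derive_n f (S n) x = Derive_n g n x.
Proof.
  intros HD Hf Hx.
  replace (S n) with (n + 1)%nat by lia.
  rewrite <- (Derive_n_comp f n 1 x).
  apply Derive_n_ext_loc.
  apply (filter_imp D); [|exact (HD x Hx)].
  intros t Ht; exact (is_derive_unique _ _ _ (Hf t Ht)).
Qed.

Lemma ex_derive_n_of_differentiable_upto (D : R -> Prop) n f x :
  open D -> differentiable_upto D n f -> D x -> ex_derive_n f n x.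
Proof.
  intros HD; revert f x; induction n as [|n IH]; intros f x; [easy|].
  intros [g [Hf Hg]] Hx.
  destruct n as [|n]; [exists (g x); exact (Hf x Hx)|].
  change (ex_derive (Derive_n f (S n)) x).
  apply (ex_derive_ext_loc (Derive_n g n)).
  - apply (filter_imp D); [|exact (HD x Hx)].
    intros t Ht; symmetry; exact (Derive_n_S_of_is_derive D f g n t HD Hf Ht).
  - exact (IH g x Hg Hx).
Qed.

(** * Power series in [q ^ x] *)

(** All the series in use have radius at least 1, and are evaluated only at points
    [q ^ x] of [0, 1), so this single condition settles every convergence
    question. *)
Definition converges_on_disk (a : nat -> R) : Prop := Rbar_le 1 (CV_radius a).

Lemma converges_on_disk_lt a u :
  converges_on_disk a -> 0 <= u < 1 -> Rbar_lt (Rabs u) (CV_radius a).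
Proof.
  intros Ha Hu; apply Rbar_lt_le_trans with 1; [|exact Ha].
  simpl; rewrite Rabs_pos_eq; lra.
Qed.

Lemma ex_pseries_on_disk a u :
  converges_on_disk a -> 0 <= u < 1 -> ex_pseries a u.
Proof.
  intros Ha Hu; apply CV_radius_inside, converges_on_disk_lt; assumption.
Qed.

Lemma converges_on_disk_bounded a M :
  (forall n, Rabs (a n) <= M) -> converges_on_disk a.
Proof.
  intros H; apply (proj1 (CV_radius_bounded a)).
  exists M; intros n; rewrite pow1, Rmult_1_r; apply H.
Qed.

Lemma converges_on_disk_scal c a :
  converges_on_disk a -> converges_on_disk (PS_scal c a).
Proof.
  intros Ha; destruct (Req_dec c 0) as [->|Hc].
  - apply converges_on_disk_bounded with 0; intros n.
    change (Rabs (0 * a n) <= 0); rewrite Rmult_0_l, Rabs_R0; lra.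
  - unfold converges_on_disk; rewrite CV_radius_scal; assumption.
Qed.

Lemma converges_on_disk_plus a b :
  converges_on_disk a -> converges_on_disk b ->
  converges_on_disk (PS_plus a b).
Proof.
  intros Ha Hb.
  apply Rbar_le_trans with (2 := CV_radius_plus a b).
  apply Rbar_min_case; assumption.
Qed.

(** The coefficients of d/dx of [sum_k a_k q ^ (x k)]. *)
Definition q_derive (q : R) (a : nat -> R) (k : nat) : R :=
  ln q * (INR k * a k).

Lemma q_derive_eq q a k :
  q_derive q a k = PS_scal (ln q) (PS_incr_1 (PS_derive a)) k.
Proof.
  unfold q_derive, PS_scal, PS_incr_1, PS_derive, scal; simpl; unfold mult; simpl.
  destruct k as [|k]; [simpl; unfold zero; simpl; ring | reflexivity].
Qed.

Lemma ln_neg q : 0 < q -> q < 1 -> ln q < 0.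
Proof. intros; rewrite <- ln_1; apply ln_increasing; assumption. Qed.

Lemma converges_on_disk_q_derive q a :
  0 < q -> q < 1 -> converges_on_disk a -> converges_on_disk (q_derive q a).
Proof.
  intros h0 h1 Ha; pose proof (ln_neg q h0 h1) as Hl.
  unfold converges_on_disk.
  rewrite (CV_radius_ext _ _ (q_derive_eq q a)), CV_radius_scal by lra.
  rewrite CV_radius_incr_1, CV_radius_derive; exact Ha.
Qed.

Lemma Rpower_unit q x : 0 < q -> q < 1 -> 0 < x -> 0 < Rpower q x < 1.
Proof.
  intros h0 h1 hx; pose proof (ln_neg q h0 h1) as Hl; split.
  - apply exp_pos.
  - unfold Rpower; rewrite <- exp_0; apply exp_increasing; nra.
Qed.

Lemma is_derive_Rpower_base q x :
  is_derive (fun t => Rpower q t) x (ln q * Rpower q x).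
Proof. unfold Rpower; auto_derive; [exact I | ring]. Qed.

Lemma is_derive_PSeries_Rpower q a x :
  0 < q -> q < 1 -> 0 < x -> converges_on_disk a ->
  is_derive (fun t => PSeries a (Rpower q t)) x
    (PSeries (q_derive q a) (Rpower q x)).
Proof.
  intros h0 h1 hx Ha.
  pose proof (Rpower_unit q x h0 h1 hx) as Hu.
  rewrite (PSeries_ext _ _ _ (q_derive_eq q a)), PSeries_scal, PSeries_incr_1.
  rewrite <- Rmult_assoc.
  apply (is_derive_comp (PSeries a) (fun t => Rpower q t)).
  - apply is_derive_PSeries, converges_on_disk_lt; [exact Ha | lra].
  - apply is_derive_Rpower_base.
Qed.

Lemma open_pos : open (fun x => 0 < x).
Proof. apply open_gt. Qed.

Lemma differentiable_PSeries_Rpower q n :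
  0 < q -> q < 1 -> forall a, converges_on_disk a ->
  differentiable_upto (fun x => 0 < x) n (fun x => PSeries a (Rpower q x)).
Proof.
  intros h0 h1; induction n as [|n IH]; intros a Ha; [exact I|].
  exists (fun x => PSeries (q_derive q a) (Rpower q x)); split.
  - intros x Hx; apply is_derive_PSeries_Rpower; assumption.
  - apply IH, converges_on_disk_q_derive; assumption.
Qed.

Lemma PSeries_nonneg a u :
  0 <= u < 1 -> converges_on_disk a -> (forall k, 0 <= a k) ->
  0 <= PSeries a u.
Proof.
  intros Hu Ha H.
  replace 0 with (Series (fun _ => 0 * 0)) by (rewrite Series_scal_l; ring).
  apply Series_le.
  - intros k; rewrite Rmult_0_l; split; [lra|].
    apply Rmult_le_pos; [apply H | apply pow_le; lra].
  - apply ex_pseries_R, ex_pseries_on_disk; assumption.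
Qed.

(** Each derivative multiplies the coefficients by [ln q * k <= 0]; the factor -1
    extracted at each step keeps them nonnegative for the induction. *)
Lemma PSeries_Rpower_alternating q n :
  0 < q -> q < 1 -> forall a x, 0 < x -> converges_on_disk a ->
  (forall k, 0 <= a k) ->
  0 <= (-1) ^ n * Derive_n (fun t => PSeries a (Rpower q t)) n x.
Proof.
  intros h0 h1; pose proof (ln_neg q h0 h1) as Hl.
  induction n as [|n IH]; intros a x hx Ha H.
  - simpl; rewrite Rmult_1_l.
    pose proof (Rpower_unit q x h0 h1 hx).
    apply PSeries_nonneg; [lra | assumption | assumption].
  - rewrite (Derive_n_S_of_is_derive (fun x => 0 < x) _
      (fun t => PSeries (q_derive q a) (Rpower q t)) n x open_pos); cycle 1.
    { intros t Ht; apply is_derive_PSeries_Rpower; assumption. }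
    { exact hx. }
    rewrite (Derive_n_ext _
      (fun t => -1 * PSeries (PS_scal (-1) (q_derive q a)) (Rpower q t))); cycle 1.
    { intros t; rewrite PSeries_scal; ring. }
    rewrite Derive_n_scal_l.
    match goal with |- 0 <= ?e => replace e with
      ((-1) ^ n * Derive_n (fun t =>
         PSeries (PS_scal (-1) (q_derive q a)) (Rpower q t)) n x)
      by (simpl; ring) end.
    apply IH; [exact hx | |].
    + apply converges_on_disk_scal, converges_on_disk_q_derive; assumption.
    + intros k; unfold PS_scal, q_derive, scal; simpl; unfold mult; simpl.
      pose proof (pos_INR k) as Hk; specialize (H k).
      pose proof (Rmult_le_pos _ _ Hk H); nra.
Qed.

(** * The logarithm and the dilogarithm as power series *)

(** The coefficients of - log (1 - u); the constant one is 0 because [/ 0 = 0]. *)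
Definition log_coeff (k : nat) : R := / INR k.

Lemma converges_log_coeff : converges_on_disk log_coeff.
Proof.
  apply converges_on_disk_bounded with 1; intros [|k]; unfold log_coeff.
  - simpl; rewrite Rinv_0, Rabs_R0; lra.
  - assert (1 <= INR (S k)) by (rewrite S_INR; pose proof (pos_INR k); lra).
    rewrite Rabs_pos_eq by (left; apply Rinv_0_lt_compat; lra).
    rewrite <- Rinv_1; apply Rinv_le_contravar; lra.
Qed.

Lemma PS_derive_log_coeff k : PS_derive log_coeff k = 1.
Proof.
  unfold PS_derive, log_coeff; apply Rinv_r, not_0_INR; lia.
Qed.

Lemma PSeries_PS_derive_log_coeff u :
  0 <= u < 1 -> PSeries (PS_derive log_coeff) u = / (1 - u).
Proof.
  intros Hu; rewrite <- Series_geom by (rewrite Rabs_pos_eq; lra).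
  apply Series_ext; intros k; rewrite PS_derive_log_coeff; ring.
Qed.

Lemma PSeries_log_coeff u : 0 <= u < 1 -> PSeries log_coeff u = - ln (1 - u).
Proof.
  intros Hu.
  assert (H0 : PSeries log_coeff 0 + ln (1 - 0) = 0).
  { rewrite PSeries_0, Rminus_0_r, ln_1; unfold log_coeff; simpl.
    rewrite Rinv_0; ring. }
  destruct (Req_dec u 0) as [->|Hu0]; [lra|].
  enough (PSeries log_coeff 0 + ln (1 - 0) = PSeries log_coeff u + ln (1 - u))
    by lra.
  apply (eq_is_derive (fun t => PSeries log_coeff t + ln (1 - t))); [|lra].
  intros t Ht.
  change (is_derive (fun t => PSeries log_coeff t + ln (1 - t)) t 0).
  rewrite <- (Rplus_opp_r (/ (1 - t))).
  apply (is_derive_plus (PSeries log_coeff) (fun t => ln (1 - t))).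
  - rewrite <- PSeries_PS_derive_log_coeff by lra.
    apply is_derive_PSeries, converges_on_disk_lt;
      [exact converges_log_coeff | lra].
  - auto_derive; [lra | field; lra].
Qed.

Lemma PSeries_q_derive_log_coeff q u :
  0 <= u < 1 -> PSeries (q_derive q log_coeff) u = ln q * (u / (1 - u)).
Proof.
  intros Hu; rewrite (PSeries_ext _ _ _ (q_derive_eq q log_coeff)).
  rewrite PSeries_scal, PSeries_incr_1, PSeries_PS_derive_log_coeff by lra.
  reflexivity.
Qed.

Lemma PSeries_log_coeff_shift t :
  0 < t < 1 -> PSeries (PS_decr_1 log_coeff) t = - ln (1 - t) / t.
Proof.
  intros Ht; rewrite <- PSeries_log_coeff by lra.
  rewrite (PSeries_decr_1 log_coeff)
    by (apply ex_pseries_on_disk; [exact converges_log_coeff | lra]).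
  unfold log_coeff at 2; simpl; rewrite Rinv_0; field; lra.
Qed.

(** The series extends the integrand continuously to 0, where the quotient
    [ln (1 - t) / t] has no meaning of its own; the value at an end point does
    not affect the integral. *)
Lemma dilog_RInt z :
  0 < z < 1 -> dilog z = RInt (PSeries (PS_decr_1 log_coeff)) 0 z.
Proof.
  intros Hz; unfold dilog.
  rewrite <- (Ropp_involutive (RInt (PSeries _) 0 z)); f_equal.
  assert (Hex : ex_RInt (PSeries (PS_decr_1 log_coeff)) 0 z).
  { eexists; apply is_RInt_PSeries.
    rewrite CV_radius_decr_1; apply converges_on_disk_lt;
      [exact converges_log_coeff | lra]. }
  transitivity (RInt (fun t => opp (PSeries (PS_decr_1 log_coeff) t)) 0 z).
  - apply RInt_ext; rewrite Rmin_left, Rmax_right by lra; intros t Ht.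
    rewrite PSeries_log_coeff_shift by lra.
    unfold opp; simpl; field; lra.
  - exact (RInt_opp _ _ _ Hex).
Qed.

Lemma is_derive_dilog z : 0 < z < 1 -> is_derive dilog z (- ln (1 - z) / z).
Proof.
  intros Hz.
  assert (Hc : forall u, 0 <= u < 1 ->
    Rbar_lt (Rabs u) (CV_radius (PS_decr_1 log_coeff))).
  { intros u Hu; rewrite CV_radius_decr_1; apply converges_on_disk_lt;
      [exact converges_log_coeff | exact Hu]. }
  assert (Hloc : locally z (fun t => 0 < t < 1)).
  { apply (open_and (fun t => 0 < t) (fun t => t < 1));
      [apply open_gt | apply open_lt | exact Hz]. }
  replace (- ln (1 - z) / z) with (PSeries (PS_decr_1 log_coeff) z).
  - apply (is_derive_ext_loc (fun t => RInt (PSeries (PS_decr_1 log_coeff)) 0 t)).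
    + apply (filter_imp (fun t => 0 < t < 1)); [|exact Hloc].
      intros t Ht; symmetry; apply dilog_RInt; exact Ht.
    + apply (is_derive_RInt (PSeries (PS_decr_1 log_coeff)) _ 0).
      * apply (filter_imp (fun t => 0 < t < 1)); [|exact Hloc].
        intros t Ht; apply (RInt_correct (V := R_CompleteNormedModule)).
        eexists; apply is_RInt_PSeries, Hc; lra.
      * apply continuity_pt_filterlim, PSeries_continuity, Hc; lra.
  - apply PSeries_log_coeff_shift; exact Hz.
Qed.

(** * The logarithm of the q-gamma function *)

(** Expanding log (1 - q^j u) in powers of u and summing the geometric series over
    j gives these coefficients for - log of the product over j of (1 - q^j u);
    the constant one is 0 because [/ 0 = 0]. *)
Definition qgamma_coeff (q : R) (k : nat) : R := / (INR k * (1 - q ^ k)).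

Lemma pow_S_unit q k : 0 < q -> q < 1 -> 0 < q ^ S k <= q.
Proof.
  intros h0 h1; split; [apply pow_lt; lra|].
  pose proof (pow_incr q 1 k (conj (Rlt_le _ _ h0) (Rlt_le _ _ h1))) as H.
  rewrite pow1 in H; simpl; pose proof (pow_lt q k h0); nra.
Qed.

Lemma converges_qgamma_coeff q b :
  0 < q -> q < 1 -> 0 <= b <= 1 ->
  converges_on_disk (fun k => qgamma_coeff q k * b ^ k).
Proof.
  intros h0 h1 hb; apply converges_on_disk_bounded with (/ (1 - q)).
  assert (Hq : 0 < / (1 - q)) by (apply Rinv_0_lt_compat; lra).
  intros [|k]; unfold qgamma_coeff.
  - simpl; rewrite Rmult_0_l, Rinv_0, Rmult_0_l, Rabs_R0; lra.
  - pose proof (pow_S_unit q k h0 h1) as Hp.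
    assert (1 <= INR (S k)) by (rewrite S_INR; pose proof (pos_INR k); lra).
    assert (Hd : 1 - q <= INR (S k) * (1 - q ^ S k)) by nra.
    assert (Hi : 0 < / (INR (S k) * (1 - q ^ S k)) <= / (1 - q)).
    { split; [apply Rinv_0_lt_compat; lra | apply Rinv_le_contravar; lra]. }
    assert (Hb : 0 <= b ^ S k <= 1).
    { split; [apply pow_le; lra|].
      rewrite <- (pow1 (S k)); apply pow_incr; lra. }
    rewrite Rabs_pos_eq by nra; nra.
Qed.

Lemma PSeries_dilate a b u :
  PSeries (fun k => a k * b ^ k) u = PSeries a (b * u).
Proof.
  apply Series_ext; intros k; rewrite Rpow_mult_distr; ring.
Qed.

(** Minus the logarithm of the q-Pochhammer symbol (u; q)_oo. *)
Definition neglog_qpoch (q u : R) : R := PSeries (qgamma_coeff q) u.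

Lemma converges_qgamma_coeff_1 q :
  0 < q -> q < 1 -> converges_on_disk (qgamma_coeff q).
Proof.
  intros h0 h1; unfold converges_on_disk.
  rewrite (CV_radius_ext _ (fun k => qgamma_coeff q k * 1 ^ k))
    by (intros k; rewrite pow1; ring).
  apply converges_qgamma_coeff; lra.
Qed.

(** The functional equation (u; q)_oo = (1 - u) (q u; q)_oo. It holds
    coefficientwise:
    1 / (k (1 - q^k)) = q^k / (k (1 - q^k)) + 1 / k. *)
Lemma neglog_qpoch_step q u :
  0 < q -> q < 1 -> 0 <= u < 1 ->
  neglog_qpoch q u = neglog_qpoch q (q * u) - ln (1 - u).
Proof.
  intros h0 h1 hu; unfold neglog_qpoch.
  unfold Rminus at 1.
  rewrite <- (PSeries_log_coeff u hu), <- PSeries_dilate.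
  rewrite <- PSeries_plus.
  - apply PSeries_ext; intros [|k]; unfold PS_plus, plus, log_coeff, qgamma_coeff.
    + simpl; rewrite Rmult_0_l, Rinv_0; ring.
    + simpl (AbelianMonoid.plus _ _).
      pose proof (pow_S_unit q k h0 h1) as Hp.
      change (/ (INR (S k) * (1 - q ^ S k)) =
        / (INR (S k) * (1 - q ^ S k)) * q ^ S k + / INR (S k)).
      set (p := q ^ S k) in *; field; split; [apply not_0_INR; lia | lra].
  - apply ex_pseries_on_disk; [apply converges_qgamma_coeff; lra | exact hu].
  - apply ex_pseries_on_disk; [exact converges_log_coeff | exact hu].
Qed.

Lemma one_minus_eq_exp_neglog_qpoch q u :
  0 < q -> q < 1 -> 0 <= u < 1 ->
  1 - u = exp (neglog_qpoch q (q * u) - neglog_qpoch q u).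
Proof.
  intros h0 h1 hu; rewrite (neglog_qpoch_step q u h0 h1 hu).
  replace (neglog_qpoch q (q * u) - (neglog_qpoch q (q * u) - ln (1 - u)))
    with (ln (1 - u)) by ring.
  rewrite exp_ln; lra.
Qed.

Lemma Rpower_INR_plus q j y :
  0 < q -> Rpower q (INR j + y) = q ^ j * Rpower q y.
Proof. intros h0; rewrite Rpower_plus, Rpower_pow by lra; reflexivity. Qed.

(** Each factor is a quotient of two values of 1 - u, hence an exponential of
    differences along the orbits of [q] and of [q ^ y] under multiplication by
    [q]; the exponents telescope. *)
Lemma qgamma_partial_product q y n :
  0 < q -> q < 1 -> 0 < y ->
  prod_f_R0
    (fun j => (1 - q ^ (j + 1)) / (1 - Rpower q (INR j + y))) n =
  exp (neglog_qpoch q (Rpower q y) - neglog_qpoch q q +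
       (neglog_qpoch q (q ^ S n * q) - neglog_qpoch q (q ^ S n * Rpower q y))).
Proof.
  intros h0 h1 hy.
  pose proof (Rpower_unit q y h0 h1 hy) as Hu.
  assert (Hfac : forall j,
    (1 - q ^ (j + 1)) / (1 - Rpower q (INR j + y)) =
    exp ((neglog_qpoch q (q ^ S j * q) - neglog_qpoch q (q ^ j * q)) -
         (neglog_qpoch q (q ^ S j * Rpower q y) -
          neglog_qpoch q (q ^ j * Rpower q y)))).
  { intros j; rewrite (Rpower_INR_plus q j y h0).
    pose proof (pow_lt q j h0) as Hj.
    pose proof (pow_incr q 1 j (conj (Rlt_le _ _ h0) (Rlt_le _ _ h1))) as Hj1.
    rewrite pow1 in Hj1.
    unfold Rminus at 3; rewrite exp_plus, exp_Ropp; unfold Rdiv.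
    f_equal; [|f_equal].
    - replace (j + 1)%nat with (S j) by lia.
      replace (q ^ S j) with (q ^ j * q) at 1 by (simpl; ring).
      rewrite (one_minus_eq_exp_neglog_qpoch q (q ^ j * q) h0 h1) by nra.
      f_equal; f_equal; f_equal; simpl; ring.
    - rewrite (one_minus_eq_exp_neglog_qpoch q (q ^ j * Rpower q y) h0 h1) by nra.
      f_equal; f_equal; f_equal; simpl; ring. }
  induction n as [|n IH].
  - unfold prod_f_R0; rewrite Hfac; f_equal; rewrite !pow_O, !Rmult_1_l; ring.
  - cbn [prod_f_R0]; rewrite IH, Hfac, <- exp_plus; f_equal; ring.
Qed.

Lemma is_lim_neglog_qpoch q v :
  0 < q -> q < 1 -> is_lim_seq (fun n => neglog_qpoch q (q ^ S n * v)) 0.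
Proof.
  intros h0 h1.
  replace 0 with (neglog_qpoch q 0).
  2:{ unfold neglog_qpoch; rewrite PSeries_0; unfold qgamma_coeff; simpl.
      rewrite Rmult_0_l; apply Rinv_0. }
  apply (is_lim_seq_continuous (neglog_qpoch q)).
  - apply PSeries_continuity, converges_on_disk_lt; [|lra].
    apply converges_qgamma_coeff_1; assumption.
  - replace (Finite 0) with (Rbar_mult 0 v) by (simpl; f_equal; ring).
    apply (is_lim_seq_scal_r (fun n => q ^ S n) v 0).
    apply (is_lim_seq_incr_1 (fun n => q ^ n)).
    apply is_lim_seq_geom; rewrite Rabs_pos_eq; lra.
Qed.

Lemma qgamma_eq_exp q y :
  0 < q -> q < 1 -> 0 < y ->
  qgamma q y =
  exp ((1 - y) * ln (1 - q) + (neglog_qpoch q (Rpower q y) - neglog_qpoch q q)).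
Proof.
  intros h0 h1 hy; unfold qgamma.
  rewrite exp_plus; f_equal.
  rewrite (is_lim_seq_unique _
    (exp (neglog_qpoch q (Rpower q y) - neglog_qpoch q q))); [reflexivity|].
  eapply is_lim_seq_ext.
  { intros n; symmetry; exact (qgamma_partial_product q y n h0 h1 hy). }
  apply (is_lim_seq_continuous exp).
  - apply derivable_continuous_pt, derivable_pt_exp.
  - replace (Finite (neglog_qpoch q (Rpower q y) - neglog_qpoch q q))
      with (Finite (neglog_qpoch q (Rpower q y) - neglog_qpoch q q + (0 - 0)))
      by (f_equal; ring).
    apply is_lim_seq_plus'; [apply is_lim_seq_const|].
    apply is_lim_seq_minus'; apply is_lim_neglog_qpoch; assumption.
Qed.

(** * The logarithmic derivative of [f_ab] *)

Definition log_f (alpha beta q x : R) : R :=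
  (1 - (x + beta)) * ln (1 - q)
  + (neglog_qpoch q (Rpower q beta * Rpower q x) - neglog_qpoch q q)
  - dilog (1 - Rpower q x) / ln q
  - (x + beta - alpha) * (ln (1 - Rpower q x) - ln (1 - q)).

Lemma f_ab_eq_exp alpha beta q x :
  0 < q -> q < 1 -> 0 <= beta -> 0 < x ->
  f_ab alpha beta q x = exp (log_f alpha beta q x).
Proof.
  intros h0 h1 hb hx; unfold f_ab, log_f.
  pose proof (Rpower_unit q x h0 h1 hx) as Hu.
  rewrite qgamma_eq_exp by lra.
  rewrite (Rplus_comm x beta) at 2; rewrite Rpower_plus.
  unfold Rpower at 4; rewrite ln_div by lra.
  unfold Rdiv at 1; rewrite <- exp_Ropp, <- !exp_plus.
  f_equal; unfold Rdiv; ring.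
Qed.

Definition log_f_coeff (alpha beta q : R) : nat -> R :=
  PS_plus log_coeff
    (PS_plus (PS_scal (beta - alpha) (q_derive q log_coeff))
       (q_derive q (fun k => qgamma_coeff q k * Rpower q beta ^ k))).

Lemma converges_q_derive_qgamma_coeff beta q :
  0 < q -> q < 1 -> 0 < beta ->
  converges_on_disk
    (q_derive q (fun k => qgamma_coeff q k * Rpower q beta ^ k)).
Proof.
  intros h0 h1 hb; pose proof (Rpower_unit q beta h0 h1 hb) as Hb.
  apply converges_on_disk_q_derive; [lra | lra |].
  apply converges_qgamma_coeff; lra.
Qed.

Lemma converges_log_f_coeff alpha beta q :
  0 < q -> q < 1 -> 0 < beta ->
  converges_on_disk (log_f_coeff alpha beta q).
Proof.
  intros h0 h1 hb; repeat apply converges_on_disk_plus.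
  - exact converges_log_coeff.
  - apply converges_on_disk_scal, converges_on_disk_q_derive;
      [lra | lra | exact converges_log_coeff].
  - apply converges_q_derive_qgamma_coeff; assumption.
Qed.

Lemma PSeries_log_f_coeff alpha beta q u :
  0 < q -> q < 1 -> 0 < beta -> 0 <= u < 1 ->
  PSeries (log_f_coeff alpha beta q) u =
  - ln (1 - u)
  + ((beta - alpha) * (ln q * (u / (1 - u)))
     + PSeries (q_derive q (fun k => qgamma_coeff q k * Rpower q beta ^ k)) u).
Proof.
  intros h0 h1 hb hu; unfold log_f_coeff.
  assert (ex_pseries log_coeff u)
    by (apply ex_pseries_on_disk; [exact converges_log_coeff | exact hu]).
  assert (ex_pseries (PS_scal (beta - alpha) (q_derive q log_coeff)) u).
  { apply ex_pseries_on_disk; [|exact hu].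
    apply converges_on_disk_scal, converges_on_disk_q_derive;
      [lra | lra | exact converges_log_coeff]. }
  assert (ex_pseries
    (q_derive q (fun k => qgamma_coeff q k * Rpower q beta ^ k)) u).
  { apply ex_pseries_on_disk; [|exact hu].
    apply converges_q_derive_qgamma_coeff; assumption. }
  rewrite !PSeries_plus by (try apply ex_pseries_plus; assumption).
  rewrite PSeries_scal, PSeries_q_derive_log_coeff, PSeries_log_coeff by lra.
  reflexivity.
Qed.

Lemma is_derive_dilog_Rpower q x :
  0 < q -> q < 1 -> 0 < x ->
  is_derive (fun t => dilog (1 - Rpower q t)) x
    (x * ln q ^ 2 * (Rpower q x / (1 - Rpower q x))).
Proof.
  intros h0 h1 hx; pose proof (Rpower_unit q x h0 h1 hx) as Hu.
  replace (x * ln q ^ 2 * (Rpower q x / (1 - Rpower q x))) with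
    (- (ln q * Rpower q x) *
     (- ln (1 - (1 - Rpower q x)) / (1 - Rpower q x))).
  - apply (is_derive_comp dilog (fun t => 1 - Rpower q t)).
    + apply is_derive_dilog; lra.
    + rewrite <- Rminus_0_l.
      apply (is_derive_minus (fun _ => 1) (fun t => Rpower q t) x 0).
      * apply (is_derive_const 1 x).
      * apply is_derive_Rpower_base.
  - replace (1 - (1 - Rpower q x)) with (Rpower q x) by ring.
    replace (ln (Rpower q x)) with (x * ln q) by (symmetry; apply ln_exp).
    field; lra.
Qed.

(** The term [x * ln q * u / (1 - u)] from the dilogarithm cancels against the one
    from the power of [(1 - u) / (1 - q)], and the two [ln (1 - q)] cancel. *)
Lemma is_derive_log_f alpha beta q x :
  0 < q -> q < 1 -> 0 < beta -> 0 < x ->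
  is_derive (log_f alpha beta q) x
    (PSeries (log_f_coeff alpha beta q) (Rpower q x)).
Proof.
  intros h0 h1 hb hx.
  pose proof (Rpower_unit q x h0 h1 hx) as Hu.
  pose proof (Rpower_unit q beta h0 h1 hb) as Hb.
  pose proof (ln_neg q h0 h1) as Hl.
  assert (Hg : converges_on_disk (fun k => qgamma_coeff q k * Rpower q beta ^ k))
    by (apply converges_qgamma_coeff; lra).
  rewrite PSeries_log_f_coeff by lra.
  assert (HR := is_derive_Rpower_base q x).
  assert (HP := is_derive_PSeries_Rpower q _ x h0 h1 hx Hg).
  assert (HD := is_derive_dilog_Rpower q x h0 h1 hx).
  assert (Hsum : forall (P D V : R -> R) (P' D' V' : R),
    is_derive P x P' -> is_derive D x D' -> is_derive V x V' -> V x < 1 ->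
    is_derive (fun t =>
      (1 - (t + beta)) * ln (1 - q) + (P t - neglog_qpoch q q) - D t / ln q
      - (t + beta - alpha) * (ln (1 - V t) - ln (1 - q))) x
      (P' - D' / ln q - (ln (1 - V x))
       + (x + beta - alpha) * (V' / (1 - V x)))).
  { intros P D V P' D' V' HP0 HD0 HV0 HV.
    auto_derive.
    - repeat split; try (eexists; eassumption); lra.
    - replace (Derive (fun t : R => P t) x) with P'
        by (symmetry; exact (is_derive_unique _ _ _ HP0)).
      replace (Derive (fun t : R => D t) x) with D'
        by (symmetry; exact (is_derive_unique _ _ _ HD0)).
      replace (Derive (fun t : R => V t) x) with V'
        by (symmetry; exact (is_derive_unique _ _ _ HV0)).
      unfold Rminus; field; lra. }
  apply (is_derive_ext (fun t =>
    (1 - (t + beta)) * ln (1 - q)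
    + (PSeries (fun k => qgamma_coeff q k * Rpower q beta ^ k) (Rpower q t)
       - neglog_qpoch q q)
    - dilog (1 - Rpower q t) / ln q
    - (t + beta - alpha) * (ln (1 - Rpower q t) - ln (1 - q)))).
  { intros t; unfold log_f, neglog_qpoch; rewrite PSeries_dilate; reflexivity. }
  match goal with |- is_derive _ _ ?e => replace e with
    (PSeries (q_derive q (fun k => qgamma_coeff q k * Rpower q beta ^ k))
       (Rpower q x)
     - x * ln q ^ 2 * (Rpower q x / (1 - Rpower q x)) / ln q
     - ln (1 - Rpower q x)
     + (x + beta - alpha) * (ln q * Rpower q x / (1 - Rpower q x))) end.
  - exact (Hsum _ _ _ _ _ _ HP HD HR (proj2 Hu)).
  - field; lra.
Qed.

(** * The sign of the coefficients *)

(** This is tanh (t/2) <= t/2 cleared of denominators. The difference vanishes at 0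
    and has derivative 1 - (1 - t) e^t, nonnegative because 1 - t <= e^(-t). *)
Lemma tanh_half_le t : 0 <= t -> 2 * (exp t - 1) <= t * (exp t + 1).
Proof.
  intros Ht.
  destruct (MVT_gen (fun s => s * (exp s + 1) - 2 * (exp s - 1)) 0 t
    (fun s => 1 - (1 - s) * exp s)) as [c [Hc Heq]].
  - intros s _; auto_derive; [exact I | ring].
  - intros s _; apply derivable_continuous_pt; reg.
  - rewrite Rmin_left, Rmax_right in Hc by lra.
    rewrite exp_0 in Heq.
    assert (Hd : (1 - c) * exp c <= 1).
    { replace 1 with (exp (- c) * exp c) at 2
        by (rewrite <- exp_plus, Rplus_opp_l, exp_0; reflexivity).
      apply Rmult_le_compat_r; [left; apply exp_pos|].
      pose proof (exp_ineq1_le (- c)); lra. }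
    nra.
Qed.

(** The case [beta = 1], [alpha = 1/2] is [tanh_half_le]. To reach larger [beta],
    put s = beta - 1: since e^(-s t) >= 1 - s t, the last term loses at most
    s t / (e^t - 1) <= s against its value at [beta = 1], and [beta - alpha] gains
    exactly s. *)
Lemma laplace_kernel_le alpha beta t :
  2 * alpha <= 1 -> 1 <= beta -> 0 < t ->
  / t <= beta - alpha + exp (- (beta * t)) / (1 - exp (- t)).
Proof.
  intros ha hb ht.
  pose proof (exp_ineq1_le t) as HE.
  pose proof (tanh_half_le t (Rlt_le _ _ ht)) as HT.
  set (E := exp t) in *.
  assert (HtE : t / (E - 1) <= 1).
  { apply (Rmult_le_reg_r (E - 1)); [lra|]; unfold Rdiv.
    rewrite Rmult_assoc, Rinv_l; lra. }
  assert (H1 : / t <= / 2 + / (E - 1)).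
  { replace (/ 2 + / (E - 1)) with ((E + 1) / (2 * (E - 1))) by (field; lra).
    apply (Rmult_le_reg_r (t * (2 * (E - 1)))); [nra|].
    replace (/ t * (t * (2 * (E - 1)))) with (2 * (E - 1)) by (field; lra).
    replace ((E + 1) / (2 * (E - 1)) * (t * (2 * (E - 1)))) with (t * (E + 1))
      by (field; lra).
    exact HT. }
  assert (H2 : (1 - (beta - 1) * t) / (E - 1) <=
               exp (- (beta * t)) / (1 - exp (- t))).
  { replace (- (beta * t)) with (- ((beta - 1) * t) + - t) by ring.
    rewrite exp_plus, (exp_Ropp t); fold E.
    replace (exp (- ((beta - 1) * t)) * / E / (1 - / E))
      with (exp (- ((beta - 1) * t)) / (E - 1)) by (field; lra).
    apply Rmult_le_compat_r; [left; apply Rinv_0_lt_compat; lra|].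
    pose proof (exp_ineq1_le (- ((beta - 1) * t))); lra. }
  replace ((1 - (beta - 1) * t) / (E - 1))
    with (/ (E - 1) - (beta - 1) * (t / (E - 1))) in H2 by (field; lra).
  nra.
Qed.

Lemma log_f_coeff_nonpos alpha beta q k :
  0 < q -> q < 1 -> 2 * alpha <= 1 -> 1 <= beta ->
  log_f_coeff alpha beta q k <= 0.
Proof.
  intros h0 h1 ha hb.
  pose proof (ln_neg q h0 h1) as Hl.
  change (log_coeff k + ((beta - alpha) * q_derive q log_coeff k +
    q_derive q (fun k => qgamma_coeff q k * Rpower q beta ^ k) k) <= 0).
  unfold q_derive, log_coeff, qgamma_coeff.
  destruct k as [|k]; [simpl; rewrite Rmult_0_l, !Rinv_0; lra|].
  set (K := INR (S k)).
  assert (HK : 0 < K) by (apply lt_0_INR; lia).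
  set (t := - (K * ln q)).
  assert (Ht : 0 < t) by (unfold t; nra).
  assert (Hq : q ^ S k = exp (- t)).
  { rewrite <- Rpower_pow by lra; unfold Rpower, t, K; f_equal; ring. }
  assert (Hb : Rpower q beta ^ S k = exp (- (beta * t))).
  { rewrite <- Rpower_pow by apply exp_pos; rewrite Rpower_mult.
    unfold Rpower, t, K; f_equal; ring. }
  rewrite Hq, Hb.
  assert (HE : exp (- t) < 1)
    by (rewrite <- exp_0; apply exp_increasing; lra).
  pose proof (laplace_kernel_le alpha beta t ha hb Ht) as HL.
  replace (/ K + ((beta - alpha) * (ln q * (K * / K)) +
     ln q * (K * (/ (K * (1 - exp (- t))) * exp (- (beta * t))))))
    with (- ln q * (/ t - (beta - alpha + exp (- (beta * t)) / (1 - exp (- t))))).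
  - nra.
  - replace (/ K) with (- ln q * / t) at 1 by (unfold t; field; lra).
    field; lra.
Qed.

Theorem theorem3 (q alpha beta : R)
  (hq0 : 0 < q) (hq1 : q < 1) (hbeta : 0 <= beta)
  (halpha : 2 * alpha <= 1) (hbeta1 : 1 <= beta) :
  log_completely_monotonic (fun x : R => f_ab alpha beta q x) 0 p_infty.
Proof.
  set (c := log_f_coeff alpha beta q).
  assert (Hc : converges_on_disk c) by (apply converges_log_f_coeff; lra).
  assert (Hf : forall x, 0 < x ->
    f_ab alpha beta q x = exp (log_f alpha beta q x))
    by (intros; apply f_ab_eq_exp; lra).
  assert (Hd : forall x, 0 < x ->
    is_derive (log_f alpha beta q) x (PSeries c (Rpower q x)))
    by (intros; apply is_derive_log_f; lra).
  split; [|split].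
  - intros x Hx _; rewrite (Hf x Hx); apply exp_pos.
  - intros n x Hx _.
    apply (ex_derive_n_ext_loc (fun t => exp (log_f alpha beta q t))).
    { apply (filter_imp (fun t => 0 < t)); [|exact (open_pos x Hx)].
      intros t Ht; symmetry; exact (Hf t Ht). }
    apply (ex_derive_n_of_differentiable_upto (fun t => 0 < t));
      [exact open_pos | | exact Hx].
    apply (differentiable_upto_ode _ _ (fun t => PSeries c (Rpower q t))).
    + intros t Ht; rewrite Rmult_comm.
      apply (is_derive_comp exp); [apply is_derive_exp | exact (Hd t Ht)].
    + intros m; apply differentiable_PSeries_Rpower; assumption.
  - intros [|n] x Hn Hx _; [lia|].
    rewrite (Derive_n_ext_loc _ (log_f alpha beta q)); cycle 1.
    { apply (filter_imp (fun t => 0 < t)); [|exact (open_pos x Hx)].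
      intros t Ht; rewrite (Hf t Ht); apply ln_exp. }
    rewrite (Derive_n_S_of_is_derive (fun t => 0 < t) _
      (fun t => PSeries c (Rpower q t)) n x open_pos Hd Hx).
    rewrite (Derive_n_ext _
      (fun t => -1 * PSeries (PS_scal (-1) c) (Rpower q t))); cycle 1.
    { intros t; rewrite PSeries_scal; ring. }
    rewrite Derive_n_scal_l.
    match goal with |- 0 <= ?e => replace e with
      ((-1) ^ n * Derive_n (fun t => PSeries (PS_scal (-1) c) (Rpower q t)) n x)
      by (simpl; ring) end.
    apply PSeries_Rpower_alternating; [exact hq0 | exact hq1 | exact Hx | |].
    + apply converges_on_disk_scal; exact Hc.
    + intros k; change (0 <= -1 * c k).
      pose proof (log_f_coeff_nonpos alpha beta q k hq0 hq1 halpha hbeta1).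
      unfold c; lra.
Qed.
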